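(* Let $m$ be a square-free natural number. Then $$\mathrm{SL}_2(\mathbb{Z}[\tfrac1m])^{\mathrm{ab}}=\mathrm{E}_2(\mathbb{Z}[\tfrac1m])^{\mathrm{ab}}\simeq\begin{cases}0 & \text{if } 2\mid m,\ 3\mid m,\\ \mathbb{Z}/3 & \text{if } 2\mid m,\ 3\nmid m,\\ \mathbb{Z}/4 & \text{if } 2\nmid m,\ 3\mid m,\\ \mathbb{Z}/12 & \text{if } 2\nmid m,\ 3\nmid m.\end{cases}$$
   Context: For a commutative ring $A$, $\mathrm{E}_2(A)$ is the subgroup of $\mathrm{GL}_2(A)$ generated by the elementary matrices $\begin{pmatrix}1&a\\ 0&1\end{pmatrix}$ and $\begin{pmatrix}1&0\\ a&1\end{pmatrix}$, $a\in A$. $G^{\mathrm{ab}}=G/[G,G]$ is the abelianization of $G$. *)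

(* Defs.v *)
From HB Require Import structures.
From mathcomp Require Import all_boot all_order all_algebra all_fingroup.
From mathcomp Require Import boolp classical_sets.

Set Implicit Arguments.
Unset Strict Implicit.
Unset Printing Implicit Defensive.

Import GRing.Theory Num.Theory.
Local Open Scope ring_scope.

Definition square_free (m : nat) : Prop :=
  forall d : nat, (d ^ 2 %| m)%N -> d = 1%N.

Section ZInv.
Variable m : nat.

(* Z[1/m] as a subring of the rationals; m = 0 gives Z, since x / 0 = 0 in rat. *)
Definition zinv : {pred rat} :=
  fun x => `[< exists (a : int) (k : nat), x = a%:~R / m%:R ^+ k >].

Lemma zinv_subring : subring_closed zinv.
Proof.
split.
- by apply/asboolP; exists 1, 0%N; rewrite expr0 divr1.
- move=> _ _ /asboolP[a [k ->]] /asboolP[b [l ->]]; apply/asboolP.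
  have [-> | m_neq0] := eqVneq m 0%N.
    exists ((if k is 0 then a else 0) - (if l is 0 then b else 0)), 0%N.
    rewrite expr0 divr1 rmorphB /=.
    by case: k l => [|k] [|l]; rewrite !(expr0, expr0n, invr0, mulr0, divr1).
  exists (a * m%:R ^+ l - b * m%:R ^+ k), (k + l)%N.
  have mk n : (m%:R : rat) ^+ n != 0 by rewrite expf_neq0 // pnatr_eq0.
  rewrite rmorphB !rmorphM !rmorphXn /= rmorph_nat exprD.
  by rewrite -[in LHS]mulNr addf_div // mulNr.
- move=> _ _ /asboolP[a [k ->]] /asboolP[b [l ->]]; apply/asboolP.
  exists (a * b), (k + l)%N.
  by rewrite rmorphM /= exprD mulf_div.
Qed.

HB.instance Definition _ := GRing.isSubringClosed.Build rat zinv zinv_subring.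

Record Zinv : predArgType := ZInv { Zinv_val : rat; _ : Zinv_val \in zinv }.
HB.instance Definition _ := [isSub for Zinv_val].
HB.instance Definition _ := [Choice of Zinv by <:].
HB.instance Definition _ := [SubChoice_isSubComNzRing of Zinv by <:].

Definition Zinv_unit : {pred Zinv} :=
  fun x => (val x != 0) && ((val x)^-1 \in zinv).
Definition Zinv_inv (x : Zinv) : Zinv := insubd x (val x)^-1.

Lemma Zinv_mulVx : {in Zinv_unit, left_inverse 1 Zinv_inv *%R}.
Proof.
move=> x /andP[x0 xV]; apply: val_inj.
by rewrite [LHS]rmorphM /= val_insubd xV mulVf.
Qed.

Lemma Zinv_unitPl x y : y * x = 1 -> x \in Zinv_unit.
Proof.
move=> /(congr1 val) yx; have yx1 : val y * val x = 1 := yx.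
have x0 : val x != 0.
  by apply/eqP => x0; move/eqP: yx1; rewrite x0 mulr0 eq_sym oner_eq0.
by rewrite unfold_in x0 -[_^-1]mul1r -yx1 mulfK //= (valP y).
Qed.

Lemma Zinv_inv_out : {in [predC Zinv_unit], Zinv_inv =1 id}.
Proof.
move=> x; rewrite inE unfold_in /Zinv_unit negb_and negbK => H.
apply: val_inj; rewrite /Zinv_inv val_insubd; case: ifP => // xV.
by move: H; rewrite xV orbF => /eqP->; rewrite invr0.
Qed.

HB.instance Definition _ :=
  GRing.ComNzRing_hasMulInverse.Build Zinv Zinv_mulVx Zinv_unitPl Zinv_inv_out.

End ZInv.

(* MathComp's own {unit R} and {'GL_n[R]} are restricted to finite rings. *)
Section GL2.
Variable A : comUnitRingType.

Record GL2 : predArgType :=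
  MkGL2 { GL2_val :> 'M[A]_2; _ : GL2_val \is a GRing.unit }.
HB.instance Definition _ := [isSub for GL2_val].
HB.instance Definition _ := [Choice of GL2 by <:].

Implicit Types g h : GL2.

Lemma GL2_unit g : val g \is a GRing.unit. Proof. exact: valP. Qed.
Definition GL2_one : GL2 := MkGL2 (unitr1 _).
Definition GL2_inv g : GL2 := MkGL2 (etrans (unitrV _) (GL2_unit g)).
Definition GL2_mul g h : GL2 :=
  MkGL2 (etrans (unitrMl _ (GL2_unit h)) (GL2_unit g)).

Lemma GL2_mulA : associative GL2_mul.
Proof. by move=> g h k; apply: val_inj; apply: mulrA. Qed.
Lemma GL2_mul1 : left_id GL2_one GL2_mul.
Proof. by move=> g; apply: val_inj; apply: mul1r. Qed.
Lemma GL2_mulr1 : right_id GL2_one GL2_mul.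
Proof. by move=> g; apply: val_inj; apply: mulr1. Qed.
Lemma GL2_mulV : left_inverse GL2_one GL2_inv GL2_mul.
Proof. by move=> g; apply: val_inj; apply: mulVr (GL2_unit g). Qed.
Lemma GL2_mulrV : right_inverse GL2_one GL2_inv GL2_mul.
Proof. by move=> g; apply: val_inj; apply: divrr (GL2_unit g). Qed.

HB.instance Definition _ :=
  isGroup.Build GL2 GL2_mulA GL2_mul1 GL2_mulr1 GL2_mulV GL2_mulrV.

End GL2.

Local Open Scope classical_set_scope.
Local Open Scope group_scope.

Section Subgroups.
Variable G : groupType.

Record subgroup := Subgroup {
  subgroup_set :> set G;
  subgroup1 : subgroup_set 1;
  subgroupM : forall x y,
    subgroup_set x -> subgroup_set y -> subgroup_set (x * y);
  subgroupV : forall x, subgroup_set x -> subgroup_set x^-1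
}.

Definition gen_set (S : set G) : set G :=
  \bigcap_(H in [set H : subgroup | S `<=` H]) H.

Lemma gen_set1 S : gen_set S 1.
Proof. by move=> H _; apply: subgroup1. Qed.
Lemma gen_setM S x y : gen_set S x -> gen_set S y -> gen_set S (x * y).
Proof. by move=> Sx Sy H SH; apply: subgroupM; [apply: Sx | apply: Sy]. Qed.
Lemma gen_setV S x : gen_set S x -> gen_set S x^-1.
Proof. by move=> Sx H SH; apply/subgroupV/Sx. Qed.

Definition gen (S : set G) : subgroup :=
  Subgroup (@gen_set1 S) (@gen_setM S) (@gen_setV S).

Definition derived (H : subgroup) : subgroup :=
  gen [set [~ x, y] | x in H & y in H].

Definition lcoset (x : G) (H : set G) : set G := [set x * h | h in H].

(* H / [H, H] as a set of cosets, i.e. of subsets of G. Its group law is the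
   elementwise product of subsets (see ab below), so abelianizations of two
   subgroups of G are the same group as soon as these sets agree. *)
Definition ab_set (H : subgroup) : set (set G) :=
  [set lcoset x (derived H) | x in H].

Lemma mem_gen (S : set G) x : S x -> subgroup_set (gen S) x.
Proof. by move=> Sx H /(_ x Sx). Qed.

Lemma derived_sub (H : subgroup) : derived H `<=` H.
Proof.
move=> x; apply=> _ [y Hy [z Hz <-]]; rewrite /commg /conjg.
by do ![apply: subgroupM | apply: subgroupV].
Qed.

Lemma derivedJ (H : subgroup) x d : subgroup_set H x -> subgroup_set (derived H) d -> subgroup_set (derived H) (d ^ x).
Proof.
move=> Hx Dd; rewrite -[d ^ x](mulKg d^-1) invgK.
apply: subgroupM => //; apply: mem_gen.
by exists d; [apply: derived_sub | exists x].
Qed.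

Definition mul_set (C D : set G) : set G := [set x * y | x in C & y in D].
Definition inv_set (C : set G) : set G := [set x^-1 | x in C].

Lemma mul_lcoset (H : subgroup) x y : subgroup_set H x -> subgroup_set H y ->
  mul_set (lcoset x (derived H)) (lcoset y (derived H))
    = lcoset (x * y) (derived H).
Proof.
move=> Hx Hy; apply/seteqP; split=> z.
- move=> [_ [d Dd <-] [_ [e De <-] <-]].
  exists (d ^ y * e); first by apply: subgroupM => //; apply: derivedJ.
  by rewrite /conjg !mulgA mulgK.
- move=> [d Dd <-]; exists x; first by exists 1; [apply: subgroup1 | rewrite mulg1].
  by exists (y * d); [exists d | rewrite mulgA].
Qed.

Lemma inv_lcoset (H : subgroup) x : subgroup_set H x ->
  inv_set (lcoset x (derived H)) = lcoset x^-1 (derived H).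
Proof.
move=> Hx; apply/seteqP; split=> z.
- move=> [_ [d Dd <-] <-]; exists (d^-1 ^ x^-1).
    by apply: derivedJ; apply: subgroupV.
  by rewrite /conjg invgK invgM !mulgA mulVg mul1g.
- move=> [d Dd <-]; exists (x * (d^-1 ^ x)).
    by exists (d^-1 ^ x) => //; apply: derivedJ => //; apply: subgroupV.
  by rewrite /conjg !mulgA mulgV mul1g invgM invgK.
Qed.

Record ab (H : subgroup) : Type := Ab { ab_val : set G; abP : ab_set H ab_val }.

Section AbGroup.
Variable H : subgroup.

HB.instance Definition _ := gen_eqMixin (ab H).
HB.instance Definition _ := gen_choiceMixin (ab H).

Lemma ab_inj : injective (@ab_val H).
Proof.
move=> [C HC] [D HD] /= CD; move: HC; rewrite CD => HC.
by congr Ab; apply: Prop_irrelevance.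
Qed.

Lemma lcoset1 : lcoset 1 (derived H) = derived H.
Proof.
by apply/seteqP; split=> x; [move=> [y Dy <-] | exists x]; rewrite ?mul1g.
Qed.
Lemma ab_one_subproof : ab_set H (derived H).
Proof. by exists 1; [apply: subgroup1 | apply: lcoset1]. Qed.
Lemma ab_mul_subproof (C D : ab H) :
  ab_set H (mul_set (ab_val C) (ab_val D)).
Proof.
have [x Hx <-] := abP C; have [y Hy <-] := abP D; rewrite mul_lcoset //.
by exists (x * y) => //; apply: subgroupM.
Qed.
Lemma ab_inv_subproof (C : ab H) : ab_set H (inv_set (ab_val C)).
Proof.
have [x Hx <-] := abP C; rewrite inv_lcoset //.
by exists x^-1 => //; apply: subgroupV.
Qed.

Definition ab_one : ab H := Ab ab_one_subproof.
Definition ab_mul C D : ab H := Ab (ab_mul_subproof C D).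
Definition ab_inv C : ab H := Ab (ab_inv_subproof C).

Lemma ab_mulA : associative ab_mul.
Proof.
move=> C D E; apply: ab_inj => /=.
have [x Hx <-] := abP C; have [y Hy <-] := abP D; have [z Hz <-] := abP E.
by rewrite !mul_lcoset ?mulgA //; apply: subgroupM.
Qed.
Lemma ab_mul1 : left_id ab_one ab_mul.
Proof.
move=> C; apply: ab_inj => /=; have [x Hx <-] := abP C.
by rewrite -[X in mul_set X]lcoset1 mul_lcoset ?mul1g //; apply: subgroup1.
Qed.
Lemma ab_mulr1 : right_id ab_one ab_mul.
Proof.
move=> C; apply: ab_inj => /=; have [x Hx <-] := abP C.
by rewrite -[X in mul_set _ X]lcoset1 mul_lcoset ?mulg1 //; apply: subgroup1.
Qed.
Lemma ab_mulV : left_inverse ab_one ab_inv ab_mul.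
Proof.
move=> C; apply: ab_inj => /=; have [x Hx <-] := abP C.
by rewrite inv_lcoset // mul_lcoset ?mulVg ?lcoset1 //; apply: subgroupV.
Qed.
Lemma ab_mulrV : right_inverse ab_one ab_inv ab_mul.
Proof.
move=> C; apply: ab_inj => /=; have [x Hx <-] := abP C.
by rewrite inv_lcoset // mul_lcoset ?mulgV ?lcoset1 //; apply: subgroupV.
Qed.

HB.instance Definition _ :=
  isGroup.Build (ab H) ab_mulA ab_mul1 ab_mulr1 ab_mulV ab_mulrV.

End AbGroup.
End Subgroups.

Definition isomorphic (G H : groupType) : Prop :=
  exists f : {multiplicative G -> H}, bijective f.

Section LinearGroups.
Variable A : comUnitRingType.

Definition SL2_set : set (GL2 A) := [set g | \det (GL2_val g) = 1%R].

Lemma SL2_set1 : SL2_set 1.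
Proof. exact: det1. Qed.
Lemma SL2_setM g h : SL2_set g -> SL2_set h -> SL2_set (g * h).
Proof. by rewrite /SL2_set /= => g1 h1; rewrite det_mulmx g1 h1 mulr1. Qed.
Lemma SL2_setV g : SL2_set g -> SL2_set g^-1.
Proof. by rewrite /SL2_set /= => g1; rewrite det_inv g1 invr1. Qed.

Definition SL2 : subgroup (GL2 A) := Subgroup SL2_set1 SL2_setM SL2_setV.

Definition elementary_set : set (GL2 A) :=
  [set g | exists a : A, GL2_val g = (1%:M + a *: delta_mx 0 1)%R
                      \/ GL2_val g = (1%:M + a *: delta_mx 1 0)%R].

Definition E2 : subgroup (GL2 A) := gen elementary_set.

End LinearGroups.

(* Main.v *)
(* Z[1/m] is Euclidean (divide by the part of the numerator prime to m), so
   SL_2 = E_2 is generated by the elementary matrices.  In the abelianization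
   the lower elementary matrices are conjugate to upper ones, and conjugation
   by diag(u, 1/u) identifies e12(x) with e12(u^2 x); clearing denominators with
   u = m^k shows that t = [e12(1)] generates.  The Weyl element is t^3 and has
   order dividing 4, so t^12 = 1; a prime p | m is a unit, so t^(p^2) = t,
   which gives t^3 = 1 if 2 | m and t^8 = 1 if 3 | m.  For the lower bound,
   reduce modulo n = 3, 4 or 12 prime to m and use the explicit character
     (1 - c^2)(bd + 3(c-1)d + c + 3) + c(a + d - 3)
   of SL_2(Z/12), which sends e12(x) to x. *)
From HB Require Import structures.
Require Import Defs.
From mathcomp Require Import all_boot all_order all_algebra all_fingroup.
From mathcomp Require Import boolp classical_sets ring.
Import Defs.

Set Implicit Arguments.
Unset Strict Implicit.
Unset Printing Implicit Defensive.

Import GRing.Theory Num.Theory.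
Local Open Scope ring_scope.

Lemma gen_ind (G : groupType) (S P : set G) :
    (S `<=` P)%classic -> P 1%g ->
    (forall x y, P x -> P y -> P (x * y)%g) -> (forall x, P x -> P x^-1%g) ->
  (gen S `<=` P)%classic.
Proof. by move=> SP P1 PM PV x gx; apply: (gx (Subgroup P1 PM PV)). Qed.

(** * Classes in the abelianization and a criterion for it to be cyclic *)

Section Abelianization.
Variables (G : groupType) (H : subgroup G).
Implicit Types (x y d : G) (C D : ab H).
Local Open Scope group_scope.

(** Totalised by the value [1] outside [H], so that expressions in classes carry no membership
    proofs. *)
Definition ab_class x : ab H :=
  if pselect (subgroup_set H x) is left Hx then
    Ab (ex_intro2 _ _ x Hx erefl : ab_set H (lcoset x (derived H)))
  else 1.

Lemma ab_val_class x :
  subgroup_set H x -> ab_val (ab_class x) = lcoset x (derived H).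
Proof. by rewrite /ab_class; case: pselect. Qed.

Lemma ab_classM x y : subgroup_set H x -> subgroup_set H y ->
  ab_class (x * y) = ab_class x * ab_class y.
Proof.
move=> Hx Hy; apply: ab_inj; rewrite /= !ab_val_class ?mul_lcoset //.
exact: subgroupM.
Qed.

Lemma ab_class_surj C : exists2 x, subgroup_set H x & C = ab_class x.
Proof.
have [x Hx Cx] := abP C; exists x => //.
by apply: ab_inj; rewrite ab_val_class.
Qed.

Lemma ab_class1 : ab_class 1 = 1.
Proof.
apply: ab_inj; rewrite ab_val_class ?lcoset1 //; exact: subgroup1.
Qed.

Lemma ab_classV x : subgroup_set H x -> ab_class x^-1 = (ab_class x)^-1.
Proof.
move=> Hx; apply: (@mulgI _ (ab_class x)).
by rewrite -ab_classM ?mulgV ?ab_class1 //; apply: subgroupV.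
Qed.

Lemma ab_class_derived d : subgroup_set (derived H) d -> ab_class d = 1.
Proof.
move=> Dd; apply: ab_inj; rewrite ab_val_class ?lcoset1; last exact: derived_sub.
apply/seteqP; split=> [x [e De <-]|x Dx]; first exact: subgroupM.
by exists (d^-1 * x); rewrite ?mulKVg //; apply/subgroupM/Dx/subgroupV.
Qed.

Lemma ab_class_eq x y : subgroup_set H x -> subgroup_set H y ->
  ab_class x = ab_class y -> subgroup_set (derived H) (x^-1 * y).
Proof.
move=> Hx Hy /(congr1 (@ab_val _ H)); rewrite !ab_val_class // => xy.
have [] : lcoset x (derived H) y.
  by rewrite xy; exists 1; rewrite ?mulg1 //; apply: subgroup1.
by move=> d Dd <-; rewrite mulKg.
Qed.

Lemma abC C D : C * D = D * C.
Proof.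
have [x Hx ->] := ab_class_surj C; have [y Hy ->] := ab_class_surj D.
have xy : subgroup_set (derived H) [~ x, y].
  by apply: mem_gen; exists x => //; exists y.
rewrite -!ab_classM // [x * y](_ : _ = y * x * [~ x, y]).
  rewrite ab_classM ?(ab_class_derived xy) ?mulg1 //; first exact: subgroupM.
  exact: derived_sub.
by rewrite /commg /conjg !mulgA mulgK mulgV mul1g.
Qed.

Lemma ab_classJ x y : subgroup_set H x -> subgroup_set H y ->
  ab_class (x * y * x^-1) = ab_class y.
Proof.
move=> Hx Hy; have HVx := subgroupV Hx; have Hxy := subgroupM Hx Hy.
by rewrite !ab_classM // abC ab_classV // mulKg.
Qed.

Lemma ab_classX x n : subgroup_set H x -> ab_class (x ^+ n) = ab_class x ^+ n.
Proof.
move=> Hx; elim: n => [|n IHn]; first by rewrite ab_class1.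
rewrite !expgS ab_classM ?IHn //; elim: n {IHn} => [|n IHn].
  exact: subgroup1.
by rewrite expgS; apply: subgroupM.
Qed.

(** A multiplicative map to a commutative group factors through [ab H]; [f t] forces the order of
    the generator to be a multiple of [n.+1], and the power relation makes it a divisor. In the
    group ['I_n.+1] the unit [1] is the residue 0, while [inZp 1] is the residue 1. *)
Lemma ab_isomorphic_ord n (t : G) (f : G -> 'I_n.+1) :
    subgroup_set H t ->
    (forall x y, subgroup_set H x -> subgroup_set H y ->
       f (x * y) = f x * f y) ->
    f t = inZp 1 -> ab_class t ^+ n.+1 = 1 ->
    (forall x, subgroup_set H x -> exists k, ab_class x = ab_class t ^+ k) ->
  isomorphic (ab H) 'I_n.+1.
Proof.
move=> Ht fM ft tn tgen.
have H1 := subgroup1 H.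
have f1 : f 1 = 1 by apply: (@mulgI _ (f 1)); rewrite -fM // !mulg1.
have fV x : subgroup_set H x -> f x^-1 = (f x)^-1.
  move=> Hx; apply: (@mulgI _ (f x)).
  by rewrite -fM ?mulgV //; apply: subgroupV.
have fD x : subgroup_set (derived H) x -> f x = 1.
  move=> Dx; suff [] : subgroup_set H x /\ f x = 1 by [].
  move: x Dx; apply: gen_ind => [_ [x Hx [y Hy <-]]||x y [Hx fx] [Hy fy]|x [Hx fx]] //.
  - have [HVx HVy] := (subgroupV Hx, subgroupV Hy).
    have Hxy := subgroupM HVy (subgroupM Hx Hy).
    rewrite /commg /conjg; split; first exact: subgroupM.
    rewrite !fM //; last exact: subgroupM.
    by rewrite !fV // [f x * _]Zp_mulgC mulKg mulVg.
  - by split; [apply: subgroupM | rewrite fM // fx fy mulg1].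
  - by split; [apply: subgroupV | rewrite fV // fx invg1].
(* The induced map is [f] on chosen representatives; [Fclass] shows that the choice is immaterial,
   because [f] is trivial on [derived H]. *)
pose rep C : G := s2val (cid2 (ab_class_surj C)).
have Hrep C : subgroup_set H (rep C) by rewrite /rep; case: cid2.
have repK C : ab_class (rep C) = C by rewrite /rep; case: cid2.
pose F C : 'I_n.+1 := f (rep C).
have Fclass x : subgroup_set H x -> F (ab_class x) = f x.
  move=> Hx; have /fD := ab_class_eq (Hrep (ab_class x)) Hx (repK _).
  rewrite fM ?fV // => [/(congr1 (mul (F (ab_class x))))|]; last exact: subgroupV.
  by rewrite mulKVg mulg1.
have FM : {morph F : C D / C * D}.
  move=> C D; rewrite -[C]repK -[D]repK -ab_classM //.
  by rewrite !Fclass ?fM //; apply: subgroupM.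
have Ft k : F (ab_class t ^+ k) = inZp k.
  elim: k => [|k IHk].
    by rewrite expg0 -ab_class1 Fclass // f1; apply: val_inj; rewrite /= mod0n.
  rewrite expgS FM IHk Fclass // ft; apply: val_inj => /=.
  by rewrite modnDm.
exists (Multiplicative.Pack (Multiplicative.Class (isMultiplicative.Build _ _ _ FM))).
exists (fun i : 'I_n.+1 => ab_class t ^+ i) => [C|i] /=; last first.
  by rewrite Ft valZpK.
have [x Hx ->] := ab_class_surj C; have [k ->] := tgen x Hx.
rewrite Ft /= [in RHS](divn_eq k n.+1) expgnDr mulnC expgnA tn.
by rewrite expg1n mul1g.
Qed.

End Abelianization.

(** * Elementary, Weyl and diagonal matrices of size two *)

Section TwoByTwo.
Variable A : comUnitRingType.
Implicit Types (a b c d u v x y : A) (g : GL2 A).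

Definition mx2 a b c d : 'M[A]_2 :=
  \matrix_(i, j) if i == 0 then if j == 0 then a else b
                 else if j == 0 then c else d.

Lemma mx2_eta (M : 'M[A]_2) : M = mx2 (M 0 0) (M 0 1) (M 1 0) (M 1 1).
Proof.
apply/matrixP=> i j; rewrite mxE.
by case: i j => [[|[|//]] ?] [[|[|//]] ?]; congr (M _ _); apply: val_inj.
Qed.

Lemma det_mx2 a b c d : \det (mx2 a b c d) = a * d - b * c.
Proof.
rewrite (expand_det_row _ 0) !big_ord_recl big_ord0 /cofactor !det_mx11 !mxE /=.
rewrite expr0 expr1; ring.
Qed.

Lemma mx2M a b c d a' b' c' d' :
  mx2 a b c d * mx2 a' b' c' d' =
  mx2 (a * a' + b * c') (a * b' + b * d') (c * a' + d * c') (c * b' + d * d').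
Proof.
apply/matrixP=> i j; rewrite !mxE !big_ord_recl big_ord0 !mxE /= addr0.
by case: i j => [[|[|//]] ?] [[|[|//]] ?].
Qed.

(** The default is the identity when the determinant is not a unit, so the determinant condition is
    a side goal and not an argument. *)
Definition sl2 a b c d : GL2 A := insubd (1%g : GL2 A) (mx2 a b c d).

Lemma val_sl2 a b c d :
  a * d - b * c = 1 -> GL2_val (sl2 a b c d) = mx2 a b c d.
Proof.
by move=> D; apply: insubdK; rewrite -topredE /= unitmxE det_mx2 D unitr1.
Qed.

Lemma sl2_SL2 a b c d : a * d - b * c = 1 -> SL2_set (sl2 a b c d).
Proof. by move=> D; rewrite /SL2_set /= val_sl2 // det_mx2. Qed.

Lemma SL2P g : SL2_set g ->
  exists a b c d, a * d - b * c = 1 /\ g = sl2 a b c d.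
Proof.
rewrite /SL2_set /= (mx2_eta (GL2_val g)) det_mx2 => D.
do 4!eexists; split; first exact: D.
by apply: val_inj; rewrite /= val_sl2 // -mx2_eta.
Qed.

Lemma sl2M a b c d a' b' c' d' :
    a * d - b * c = 1 -> a' * d' - b' * c' = 1 ->
  (sl2 a b c d * sl2 a' b' c' d')%g =
  sl2 (a * a' + b * c') (a * b' + b * d') (c * a' + d * c') (c * b' + d * d').
Proof.
move=> D D'; apply: val_inj; rewrite /= !val_sl2 //; first exact: mx2M.
by transitivity ((a * d - b * c) * (a' * d' - b' * c')); [ring | rewrite D D' mulr1].
Qed.

Lemma sl2_1 : sl2 1 0 0 1 = 1%g.
Proof.
apply: val_inj; rewrite /= val_sl2; last by ring.
by rewrite [RHS]mx2_eta !mxE.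
Qed.

Definition e12 x := sl2 1 x 0 1.
Definition e21 x := sl2 1 0 x 1.
Definition weyl u v := sl2 0 u (- v) 0.
Definition diag2 u v := sl2 u 0 0 v.

Lemma e12_E2 x : subgroup_set (E2 A) (e12 x).
Proof.
apply: mem_gen; exists x; left; rewrite val_sl2; last by ring.
by rewrite [RHS]mx2_eta !mxE /= !(mulr0, mulr1, addr0, add0r).
Qed.

Lemma e21_E2 x : subgroup_set (E2 A) (e21 x).
Proof.
apply: mem_gen; exists x; right; rewrite val_sl2; last by ring.
by rewrite [RHS]mx2_eta !mxE /= !(mulr0, mulr1, addr0, add0r).
Qed.

Lemma elementaryP g : elementary_set g -> exists x, g = e12 x \/ g = e21 x.
Proof.
case=> x [] gx; exists x; [left | right]; apply: val_inj; rewrite /= gx val_sl2;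
  try ring; by rewrite [LHS]mx2_eta !mxE /= !(mulr0, mulr1, addr0, add0r).
Qed.

Lemma e12_SL2 x : SL2_set (e12 x).
Proof. by apply: sl2_SL2; ring. Qed.

Lemma e21_SL2 x : SL2_set (e21 x).
Proof. by apply: sl2_SL2; ring. Qed.

Lemma E2_sub_SL2 : (E2 A `<=` SL2 A)%classic.
Proof.
apply: gen_ind; [|exact: SL2_set1|exact: SL2_setM|exact: SL2_setV].
by move=> g /elementaryP[x [] ->]; [apply: e12_SL2 | apply: e21_SL2].
Qed.

Lemma e12D x y : (e12 x * e12 y)%g = e12 (x + y).
Proof. by rewrite sl2M; try ring; congr sl2; ring. Qed.

Lemma e12_0 : e12 0 = 1%g. Proof. exact: sl2_1. Qed.

Lemma e12N x : e12 (- x) = (e12 x)^-1%g.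
Proof.
by apply: (@mulgI _ (e12 x)); rewrite e12D mulgV subrr e12_0.
Qed.

Lemma e12_nat x n : e12 (x *+ n) = (e12 x ^+ n)%g.
Proof. by elim: n => [|n IHn]; rewrite ?e12_0 // mulrS expgS -e12D IHn. Qed.

Lemma weyl_SL2 u v : u * v = 1 -> SL2_set (weyl u v).
Proof. by move=> uv; apply: sl2_SL2; rewrite -uv; ring. Qed.

(** This factorization makes Weyl elements elementary and also computes the class of [weyl 1 1] in
    the abelianization. *)
Lemma weylE u v : u * v = 1 -> weyl u v = (e12 u * e21 (- v) * e12 u)%g.
Proof.
move=> uv; have D : (1 + u * - v) * 1 - u * - v = 1 by ring.
rewrite sl2M ?sl2M; try ring; try by rewrite -[RHS]D; ring.
by congr sl2; rewrite ?mulrN ?uv; ring: uv.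
Qed.

Lemma weyl_E2 u v : u * v = 1 -> subgroup_set (E2 A) (weyl u v).
Proof.
by move=> uv; rewrite weylE //; do ![apply: subgroupM | apply: e12_E2 | apply: e21_E2].
Qed.

Lemma e21_weyl x : e21 x = (weyl 1 1 * e12 (- x) * (weyl 1 1)^-1)%g.
Proof.
apply: (@mulIg _ (weyl 1 1)); rewrite mulgVK !sl2M; try ring.
by congr sl2; ring.
Qed.

Lemma diag2E u v : u * v = 1 -> diag2 u v = (weyl u v * weyl (-1) (-1))%g.
Proof.
move=> uv; rewrite sl2M; try ring; last by rewrite -uv; ring.
by congr sl2; ring.
Qed.

Lemma diag2_E2 u v : u * v = 1 -> subgroup_set (E2 A) (diag2 u v).
Proof.
move=> uv; rewrite diag2E //; apply: subgroupM; apply: weyl_E2 => //; ring.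
Qed.

Lemma e12_diag2 u v x : u * v = 1 ->
  (diag2 u v * e12 x * (diag2 u v)^-1)%g = e12 (u ^+ 2 * x).
Proof.
move=> uv; have D : u * v - 0 * 0 = 1 by rewrite uv; ring.
apply: (@mulIg _ (diag2 u v)); rewrite mulgVK !sl2M //; try ring.
by congr sl2; [ring | ring: uv | ring | ring].
Qed.

Lemma sl2_upper_E2 a b d : a * d = 1 -> subgroup_set (E2 A) (sl2 a b 0 d).
Proof.
move=> ad; have -> : sl2 a b 0 d = (diag2 a d * e12 (d * b))%g.
  rewrite sl2M; [|by rewrite ad; ring|by ring].
  by congr sl2; rewrite ?mulrA ?ad; ring.
by apply: subgroupM; [apply: diag2_E2 | apply: e12_E2].
Qed.

(** One Euclidean step: left multiplication by the elementary product [weyl 1 1 * e12 (- y)]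
    replaces the first column [(a, c)] by [(c, - r)]. *)
Lemma sl2_euclid a b c d r y : a * d - b * c = 1 -> a = r + y * c ->
    c * (y * d - b) - d * - r = 1 /\ (subgroup_set (E2 A) (sl2 c d (- r) (y * d - b)) ->
     subgroup_set (E2 A) (sl2 a b c d)).
Proof.
move=> D aE; split; first by rewrite -D aE; ring.
pose h : GL2 A := (weyl 1 1 * e12 (- y))%g.
have Eh : subgroup_set (E2 A) h.
  by apply: subgroupM; [apply: weyl_E2; ring | apply: e12_E2].
have <- : (h * sl2 a b c d)%g = sl2 c d (- r) (y * d - b).
  rewrite /h -mulgA sl2M //; last by ring.
  rewrite sl2M; [|by ring|by rewrite -[RHS]D; ring].
  by congr sl2; rewrite ?aE; ring.
by move=> Ehg; rewrite -[sl2 a b c d](mulKg h); apply/subgroupM/Ehg/subgroupV.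
Qed.

Local Notation cl := (ab_class (SL2 A)).

Lemma ab_e21 x : cl (e21 x) = cl (e12 (- x)).
Proof.
rewrite e21_weyl ab_classJ //; last exact: e12_SL2.
by apply: weyl_SL2; rewrite mulr1.
Qed.

Lemma ab_e12_sq u v x : u * v = 1 -> cl (e12 (u ^+ 2 * x)) = cl (e12 x).
Proof.
move=> uv; rewrite -(e12_diag2 x uv) ab_classJ //; last exact: e12_SL2.
by apply: sl2_SL2; rewrite uv; ring.
Qed.

Lemma ab_e12_nat n : cl (e12 n%:R) = (cl (e12 1) ^+ n)%g.
Proof. by rewrite e12_nat ab_classX //; apply: e12_SL2. Qed.

Lemma ab_e12_order12 : (cl (e12 1) ^+ 12 = 1)%g.
Proof.
have W : subgroup_set (SL2 A) (weyl 1 1) by apply: weyl_SL2; rewrite mulr1.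
have Se x : subgroup_set (SL2 A) (e12 x) by apply: e12_SL2.
have Sf x : subgroup_set (SL2 A) (e21 x) by apply: e21_SL2.
have WE : cl (weyl 1 1) = (cl (e12 1) ^+ 3)%g.
  rewrite weylE ?mulr1 // !ab_classM //; last exact: subgroupM.
  by rewrite ab_e21 opprK -mulgA.
(* The square of [weyl 1 1] is minus the identity, so its fourth power is trivial. *)
rewrite (expgnA _ 3 4) -WE -ab_classX // -[RHS]ab_class1; congr ab_class.
rewrite (expgnA _ 2 2) !expg2 sl2M; try ring.
by rewrite sl2M; try ring; rewrite -sl2_1; congr sl2; ring.
Qed.

Lemma ab_e12_unit_nat p v : p%:R * v = 1 ->
  (cl (e12 1) ^+ (p ^ 2)%N = cl (e12 1))%g.
Proof. by move=> pv; rewrite -ab_e12_nat -(ab_e12_sq 1 pv) mulr1 natrX. Qed.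

End TwoByTwo.

(** * The character of SL_2 modulo 12 as a polynomial in the matrix entries *)

Section Character.

(** Modulo 12 this is the exponent of the character of SL_2(Z) by which the square of the Dedekind
    eta function transforms. *)
Definition chi (R : comNzRingType) (a b c d : R) : R :=
  (1 - c ^+ 2) * (b * d + 3 * (c - 1) * d + c + 3) + c * (a + d - 3).

Lemma all_ordP n (P : pred 'I_n.+1) :
  all P [seq inZp i | i <- iota 0 n.+1] -> forall x, P x.
Proof.
move=> /allP sP x; apply/sP; rewrite -[x]valZpK; apply: map_f.
by rewrite mem_iota ltn_ord.
Qed.

(* [chi (g w) - chi g - 3] with [a] and [b] eliminated by [a d - b c = 1]. *)
Definition chi_defect (R : comNzRingType) (c d : R) : R :=
  5 * d + d ^+ 3 - c + c ^+ 3 - 9 * c * d + 3 * c * d ^+ 3 + 3 * c ^+ 3 * d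
  - 3 * d ^+ 2 + 3 * c ^+ 2 + 3 * c * d ^+ 2 - 3 * c ^+ 2 * d - 3.

(* Identities in two variables that hold in [Z/n] for [n] dividing 12; together
   with [a d - b c = 1] they imply that [chi] is a character, and checking them
   is far cheaper than checking [chi] on all of [SL_2(Z/12)]. *)
Definition divides12_laws (R : comNzRingType) (c d : R) : bool :=
  [&& 2 * (c - c ^+ 3) == 0, (c - c ^+ 3) * c == 0,
      (c - c ^+ 3) * (d ^+ 2 - d) == 0,
      chi_defect c d * c ^+ 2 == 0 & chi_defect c d * d ^+ 2 == 0].

Lemma divides12_lawsP n : n \in [:: 3; 4; 12]%N ->
  forall c d : 'Z_n, divides12_laws c d.
Proof.
suff: all (fun k => all (fun c => all (@divides12_laws 'Z_k c)
    [seq inZp i | i <- iota 0 (Zp_trunc k).+2])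
    [seq inZp i | i <- iota 0 (Zp_trunc k).+2]) [:: 3; 4; 12]%N.
  by move=> /allP laws /laws nlaws c; apply/all_ordP; move: c; apply/all_ordP.
(* This checks 9 + 16 + 144 pairs of residues. *)
by vm_compute.
Qed.

Section Laws.
Variable R : comNzRingType.
Hypothesis laws : forall c d : R, divides12_laws c d.
Implicit Types a b c d x : R.

(** The left side has the entries of a matrix times [e12 x]. The discrepancy is a combination of
    [a * d - b * c - 1] and the first three laws, taken at [c] and [a * x]. *)
Lemma chi_e12 a b c d x : a * d - b * c = 1 ->
  chi a (a * x + b) c (c * x + d) = chi a b c d + x.
Proof.
move=> /eqP; rewrite -subr_eq0 => /eqP D.
have /and5P[/eqP k2 /eqP kc /eqP ky _ _] := laws c (a * x).
set k := c - c ^+ 3 in k2 kc ky.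
transitivity (chi a b c d + x + (a * d - b * c - 1) * (x * (1 - c ^+ 2))
  + 2 * k * (b * x - 2 * x + a * d * x) + k * c * (3 * x - b * (a * x ^+ 2 + x))
  + k * ((a * x) ^+ 2 - a * x) * d
  - (a * d - b * c - 1) * (k * (a * x ^+ 2 + x))).
  by rewrite /chi /k; ring.
by rewrite D k2 kc ky !mul0r subr0 !addr0.
Qed.

(** The left side has the entries of a matrix times [weyl 1 1], whose own value is 3. The content is
    that [chi_defect c d] vanishes on a unimodular row [(c, d)]. *)
Lemma chi_weyl a b c d : a * d - b * c = 1 ->
  chi (- b) a (- d) c = chi a b c d + 3.
Proof.
move=> D; have /and5P[_ _ _ /eqP Ec /eqP Ed] := laws c d.
have E0 : chi_defect c d = 0.
  transitivity (chi_defect c d * (a * d - b * c) ^+ 3).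
    by rewrite D expr1n mulr1.
  (* the cube of [a d - b c] lies in the ideal generated by [c^2] and [d^2] *)
  transitivity (chi_defect c d * c ^+ 2 * (3 * a * b ^+ 2 * d - b ^+ 3 * c)
    + chi_defect c d * d ^+ 2 * (a ^+ 3 * d - 3 * a ^+ 2 * b * c)).
    by ring.
  by rewrite Ec Ed !mul0r addr0.
transitivity (chi a b c d + 3 + chi_defect c d - c * d * (a * d - b * c - 1)).
  by rewrite /chi /chi_defect; ring.
by rewrite E0 D subrr mulr0 subr0 addr0.
Qed.

End Laws.
End Character.

(** * Pulling the character back along a ring morphism *)

Section CharacterMorphism.
Variables (A : comUnitRingType) (R : comNzRingType) (phi : {rmorphism A -> R}).
Hypothesis laws : forall c d : R, divides12_laws c d.

Definition chi_mx (g : GL2 A) : R :=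
  let M := GL2_val g in
  chi (phi (M 0 0)) (phi (M 0 1)) (phi (M 1 0)) (phi (M 1 1)).

Lemma chi_mx_sl2 (a b c d : A) : a * d - b * c = 1 ->
  chi_mx (sl2 a b c d) = chi (phi a) (phi b) (phi c) (phi d).
Proof. by move=> D; rewrite /chi_mx val_sl2 // !mxE. Qed.

Lemma chi_mx_e12 x : chi_mx (e12 x) = phi x.
Proof. by rewrite chi_mx_sl2; last ring; rewrite /chi rmorph0 rmorph1; ring. Qed.

Lemma chi_mx1 : chi_mx 1%g = 0.
Proof. by rewrite -e12_0 chi_mx_e12 rmorph0. Qed.

(** Quantifying over all left factors [g] makes this condition stable under products and inverses,
    so [e12 x] and [weyl 1 1] suffice: [e21 x] is a conjugate by [e21_weyl]. *)
Let additive (h : GL2 A) :=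
  SL2_set h /\ forall g, SL2_set g -> chi_mx (g * h)%g = chi_mx g + chi_mx h.

Let additiveM h k : additive h -> additive k -> additive (h * k)%g.
Proof.
move=> [Sh hP] [Sk kP]; split; first exact: SL2_setM.
move=> g Sg; have Sgh := SL2_setM Sg Sh.
by rewrite mulgA (kP _ Sgh) (kP _ Sh) (hP _ Sg); apply/esym/addrA.
Qed.

Let additiveV h : additive h -> additive h^-1%g.
Proof.
move=> [Sh hP]; have SVh := SL2_setV Sh; split=> // g Sg.
apply: (addIr (chi_mx h)); have SgV := SL2_setM Sg SVh.
by rewrite -[RHS]addrA -(hP _ SgV) -(hP _ SVh) mulgVK mulVg chi_mx1 addr0.
Qed.

Let additive_e12 x : additive (e12 x).
Proof.
split=> [|g /SL2P[a [b [c [d [D ->]]]]]]; first exact: e12_SL2.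
have pD : phi a * phi d - phi b * phi c = 1.
  by rewrite -!rmorphM -rmorphB D rmorph1.
rewrite chi_mx_e12 sl2M //; last by ring.
rewrite !chi_mx_sl2 // -?(chi_e12 laws) //.
  by rewrite !rmorphD !rmorphM rmorph0 rmorph1 !mulr1 !mulr0 !addr0.
by rewrite -[RHS]D; ring.
Qed.

Let additive_weyl : additive (weyl 1 1).
Proof.
have D1 : 0 * 0 - 1 * - 1 = 1 :> A by ring.
split=> [|g /SL2P[a [b [c [d [D ->]]]]]]; first exact: weyl_SL2 (mulr1 1).
have pD : phi a * phi d - phi b * phi c = 1.
  by rewrite -!rmorphM -rmorphB D rmorph1.
rewrite sl2M // !chi_mx_sl2 //; last by rewrite -[RHS]D; ring.
have -> : chi (phi 0) (phi 1) (phi (-1)) (phi 0) = 3.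
  by rewrite rmorphN rmorph0 rmorph1 /chi; ring.
rewrite -(chi_weyl laws) // -!rmorphN.
by congr (chi (phi _) (phi _) (phi _) (phi _)); ring.
Qed.

Lemma chi_mxM g h : SL2_set g -> subgroup_set (E2 A) h ->
  chi_mx (g * h)%g = chi_mx g + chi_mx h.
Proof.
move=> Sg Eh; suff [_] : additive h by apply.
move: h Eh; apply: gen_ind; last exact: additiveV; last exact: additiveM.
  move=> h /elementaryP[x [] ->]; first exact: additive_e12.
  rewrite e21_weyl; apply/additiveM/additiveV/additive_weyl.
  exact/additiveM/additive_e12/additive_weyl.
by split=> [|k _]; [exact: SL2_set1 | rewrite mulg1 chi_mx1 addr0].
Qed.

End CharacterMorphism.

(** [ratr] reads a fraction in lowest terms; a common factor cancels in [R] because it divides the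
    unit [b]. *)
Lemma ratr_frac (R : comUnitRingType) (a b : int) :
    b != 0 -> (b%:~R : R) \is a GRing.unit ->
  ratr (a%:~R / b%:~R) = a%:~R / b%:~R :> R.
Proof.
case: divqP => // k x k0 _; rewrite !rmorphM /= unitrM => /andP[Uk Ux].
by rewrite /ratr invrM // [k%:~R * _]mulrC mulrACA divrr // mulr1.
Qed.

(** * Division in Z[1/m], equality of SL_2 and E_2, and the generator of the abelianization *)

Section ZinvTheory.
Variable m : nat.
Hypothesis m_gt0 : (0 < m)%N.
Local Notation A := (Zinv m).
Implicit Types (x y u v : A) (g h : GL2 A).

Lemma Zinv_natE n : val (n%:R : A) = n%:R.
Proof. by rewrite rmorph_nat. Qed.

Lemma Zinv_intE (a : int) : val (a%:~R : A) = a%:~R.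
Proof. by rewrite rmorph_int. Qed.

Lemma Zinv_unit_m : exists v : A, m%:R * v = 1.
Proof.
have V : (m%:R)^-1 \in zinv m by apply/asboolP; exists 1, 1%N; rewrite mul1r.
exists (ZInv V); apply: val_inj; rewrite rmorphM /= Zinv_natE.
by rewrite mulfV // pnatr_eq0 -lt0n.
Qed.

Lemma Zinv_unit_dvd p : (p %| m)%N -> exists v : A, p%:R * v = 1.
Proof.
case/dvdnP=> q mE; have [v mv] := Zinv_unit_m; exists (q%:R * v).
by rewrite mulrA -natrM mulnC -mE.
Qed.

Lemma Zinv_frac v x : m%:R * v = 1 -> exists (a : int) k, x = a%:~R * v ^+ k.
Proof.
move=> mv; have /asboolP[a [k xE]] := valP x; exists a, k; apply: val_inj.
have vE : val v = m%:R^-1.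
  apply: (mulfI (_ : m%:R != 0)); first by rewrite pnatr_eq0 -lt0n.
  rewrite -Zinv_natE -rmorphM mv Zinv_natE mulfV //.
  by rewrite pnatr_eq0 -lt0n.
transitivity (val (a%:~R : A) * val v ^+ k).
  by rewrite Zinv_intE vE xE exprVn.
by rewrite rmorphM rmorphXn.
Qed.

(** Write [x] as a / m^k and choose s m^k + t n = 1. Then x = a s + n t x, and the integer a s is
    divided by [n] with remainder. *)
Lemma Zinv_div_lt n x : (0 < n)%N -> coprime m n ->
  exists (r : nat) y, (r < n)%N /\ x = r%:R + n%:R * y.
Proof.
move=> n_gt0 co_mn; have [v mv] := Zinv_unit_m.
have [a [k ->]] := Zinv_frac x mv.
have /coprimezP[[s t] /= st] : coprimez (m ^ k)%N n by rewrite coprimezE coprimeXl.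
have n_neq0 : n%:Z != 0 by rewrite -lt0n.
have mvk : m%:R ^+ k * v ^+ k = 1 :> A by rewrite -exprMn mv expr1n.
have stA : s%:~R * m%:R ^+ k + t%:~R * n%:R = 1 :> A.
  rewrite -natrX -[(m ^ k)%:R]/((m ^ k)%:Z%:~R) -[n%:R]/(n%:Z%:~R).
  by rewrite -!rmorphM -rmorphD st.
exists `|(a * s %% n)%Z|%N, ((a * s %/ n)%Z%:~R + a%:~R * t%:~R * v ^+ k).
have rE : `|(a * s %% n)%Z|%N%:Z = (a * s %% n)%Z by rewrite gez0_abs ?modz_ge0.
split; first by rewrite -ltz_nat rE ltz_mod.
rewrite -[`|_|%N%:R]/(`|(a * s %% n)%Z|%N%:Z%:~R) rE.
transitivity (a%:~R * v ^+ k * (s%:~R * m%:R ^+ k + t%:~R * n%:R)).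
  by rewrite stA mulr1.
transitivity (a%:~R * s%:~R * (m%:R ^+ k * v ^+ k) + n%:R * (a%:~R * t%:~R * v ^+ k)).
  by ring.
have asE : (a * s)%:~R = (a * s %/ n)%Z%:~R * n%:R + (a * s %% n)%Z%:~R :> A.
  by rewrite {1}(divz_eq (a * s) n) rmorphD rmorphM.
rewrite mvk mulr1 -rmorphM /= asE; set q := _%:~R; set r := _%:~R; ring.
Qed.

(* Descent on [n]: factors common with [m] are moved into the unit [u]; once [n]
   is prime to [m] the column [(a, u n)] can be reduced by Euclidean division. *)
Lemma SL2_Zinv_sub n u v g : u * v = 1 -> SL2_set g ->
  GL2_val g 1 0 = u * n%:R -> subgroup_set (E2 A) g.
Proof.
elim/ltn_ind: n u v g => n IHn u v g uv /SL2P[a [b [c [d [D ->]]]]].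
rewrite val_sl2 // !mxE /= => cE.
have [n0 | n_gt0] := posnP n.
  move: cE D; rewrite n0 mulr0 => ->; rewrite mulr0 subr0.
  exact: sl2_upper_E2.
have [co_mn | nco_mn] := boolP (coprime m n).
  have [r [y [r_lt aE]]] := Zinv_div_lt a n_gt0 co_mn.
  have {}aE : a = r%:R + y * v * c.
    by rewrite aE cE [u * _]mulrC mulrACA [v * u]mulrC uv mulr1 [y * _]mulrC.
  have [D' EE] := sl2_euclid D aE; apply: EE.
  (* The new lower left entry is [- r], the unit -1 times a smaller natural number. *)
  apply: (IHn r r_lt (-1) (-1)); [by rewrite mulN1r opprK|exact: sl2_SL2|].
  by rewrite val_sl2 // mxE /= mulN1r.
have [e_gt0 e_dvd] : (0 < gcdn m n)%N /\ (gcdn m n %| m)%N.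
  by rewrite gcdn_gt0 m_gt0 dvdn_gcdl.
have [w ew] := Zinv_unit_dvd e_dvd.
apply: (IHn (n %/ gcdn m n)%N _ (u * (gcdn m n)%:R) (w * v)).
- by rewrite ltn_Pdiv // ltn_neqAle eq_sym e_gt0 andbT.
- by rewrite [w * v]mulrC mulrACA uv ew mulr1.
- exact: sl2_SL2.
- by rewrite val_sl2 // mxE /= cE -mulrA -natrM mulnC divnK // dvdn_gcdr.
Qed.

Lemma SL2_Zinv_eq_E2 : SL2 A = E2 A.
Proof.
have EqS : subgroup_set (SL2 A) = subgroup_set (E2 A).
  apply/seteqP; split; last exact: E2_sub_SL2.
  move=> g Sg; have [v mv] := Zinv_unit_m.
  have [a [k cE]] := Zinv_frac (GL2_val g 1 0) mv.
  have mvk : m%:R ^+ k * v ^+ k = 1 :> A by rewrite -exprMn mv expr1n.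
  pose s : A := (-1) ^+ (a < 0)%R.
  have ss : s * s = 1 by rewrite -expr2 sqrr_sign.
  (* The sign of [a] goes into the unit, leaving a natural number for the descent. *)
  apply: (@SL2_Zinv_sub `|a|%N (s * v ^+ k) (s * m%:R ^+ k)) => //.
    by rewrite mulrACA ss mul1r mulrC.
  by rewrite cE {1}[a]intEsign rmorphM rmorph_sign /= mulrAC.
(* Equal sets are upgraded to equal records, so that [E2] can be rewritten inside the type
   [ab (E2 A)]. *)
case: (SL2 A) (E2 A) EqS => [S S1 SM SV] [T T1 TM TV] /= ST.
case: T / ST T1 TM TV => T1 TM TV.
by congr Subgroup; apply: Prop_irrelevance.
Qed.

Local Notation cl := (ab_class (SL2 A)).

Lemma ab_e12_gen g : SL2_set g -> exists k, (cl g = cl (e12 1) ^+ k)%g.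
Proof.
pose t := cl (e12 1).
(* Since [t ^+ 12 = 1], inverses are positive powers, and natural exponents suffice throughout. *)
have tV k : ((t ^+ k)^-1 = t ^+ (11 * k))%g.
  apply: (@mulgI _ (t ^+ k)%g); rewrite mulgV -expgnDr -mulSn expgnA.
  by rewrite ab_e12_order12 expg1n.
have e12_int (a : int) : exists k, cl (e12 a%:~R) = (t ^+ k)%g.
  case: a => n; first by exists n; apply: ab_e12_nat.
  exists (11 * n.+1)%N; rewrite -tV -ab_e12_nat -ab_classV; last exact: e12_SL2.
  by rewrite -e12N NegzE rmorphN.
have e12_gen x : exists k, cl (e12 x) = (t ^+ k)%g.
  have [v mv] := Zinv_unit_m; have [a [k ->]] := Zinv_frac x mv.
  have mvk : m%:R ^+ k * v ^+ k = 1 :> A by rewrite -exprMn mv expr1n.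
  have zE : (a * (m ^ k)%N)%:~R = a%:~R * m%:R ^+ k :> A.
    by rewrite rmorphM /= -natrX.
  have [l El] := e12_int (a * (m ^ k)%N); exists l.
  rewrite -(ab_e12_sq (a%:~R * v ^+ k) mvk) expr2 mulrACA mvk mulr1.
  by rewrite [_ * a%:~R]mulrC -zE.
move=> Sg; have : subgroup_set (E2 A) g by rewrite -SL2_Zinv_eq_E2.
suff: (E2 A `<=` [set h | SL2_set h /\ exists k, cl h = (t ^+ k)%g])%classic.
  by move=> EP /EP[].
apply: gen_ind => [h /elementaryP[x [] ->]||
  h h' [Sh [k hk]] [Sh' [k' hk']]|h [Sh [k hk]]].
- by split; [apply: e12_SL2 | apply: e12_gen].
- by split; [apply: e21_SL2 | rewrite ab_e21; apply: e12_gen].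
- by split; [apply: SL2_set1 | exists 0%N; rewrite ab_class1].
- split; first exact: SL2_setM.
  by exists (k + k')%N; rewrite expgnDr -hk -hk' ab_classM.
- split; first exact: SL2_setV.
  by exists (11 * k)%N; rewrite -tV -hk ab_classV.
Qed.

(** * Reduction modulo an integer prime to m *)

Section Reduction.
Variable n : nat.
Hypotheses (n_gt1 : (1 < n)%N) (co_mn : coprime m n).

(** [ratr] respects the ring structure here because denominators divide powers of [m], which are
    units modulo [n]. *)
Definition Zinv_mod (x : A) : 'Z_n := ratr (val x).

Lemma Zinv_mod_frac x : exists a b : int,
  [/\ b != 0, (b%:~R : 'Z_n) \is a GRing.unit & val x = a%:~R / b%:~R].
Proof.
have /asboolP[a [k xE]] := valP x; exists a, (m ^ k)%N; split.
- by rewrite -lt0n expn_gt0 m_gt0.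
- by rewrite -[_%:~R]/((m ^ k)%:R) unitZpE // coprime_sym coprimeXl.
- by rewrite xE -natrX.
Qed.

Lemma Zinv_mod_zmod_morphism : zmod_morphism Zinv_mod.
Proof.
move=> x y; have [a [b [b0 Ub xE]]] := Zinv_mod_frac x.
have [c [d [d0 Ud yE]]] := Zinv_mod_frac y.
have Ubd : ((b * d)%:~R : 'Z_n) \is a GRing.unit by rewrite rmorphM unitrM Ub.
have xyE : val (x - y) = (a * d - c * b)%:~R / (b * d)%:~R.
  transitivity (val x - val y); first by rewrite rmorphB.
  rewrite xE yE -[- (_ / _)]mulNr addf_div ?intr_eq0 //.
  by rewrite mulNr rmorphB !rmorphM.
rewrite /Zinv_mod xyE xE yE !ratr_frac ?mulf_neq0 //.
apply: (mulIr Ubd); rewrite divrK // !(rmorphB, rmorphM) /= mulrBl.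
by rewrite mulrA divrK // [b%:~R * _]mulrC mulrA divrK.
Qed.

Lemma Zinv_mod_monoid_morphism : monoid_morphism Zinv_mod.
Proof.
split=> [|x y]; first by rewrite /Zinv_mod rmorph1 (ratr_nat _ 1).
have [a [b [b0 Ub xE]]] := Zinv_mod_frac x.
have [c [d [d0 Ud yE]]] := Zinv_mod_frac y.
have Ubd : ((b * d)%:~R : 'Z_n) \is a GRing.unit by rewrite rmorphM unitrM Ub.
have xyE : val (x * y) = (a * c)%:~R / (b * d)%:~R.
  transitivity (val x * val y); first by rewrite rmorphM.
  by rewrite xE yE mulf_div !rmorphM.
rewrite /Zinv_mod xyE xE yE !ratr_frac ?mulf_neq0 // !rmorphM /=.
by rewrite invrM // [d%:~R^-1 * _]mulrC mulrACA.
Qed.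

HB.instance Definition _ :=
  GRing.isZmodMorphism.Build A 'Z_n Zinv_mod Zinv_mod_zmod_morphism.
HB.instance Definition _ :=
  GRing.isMonoidMorphism.Build A 'Z_n Zinv_mod Zinv_mod_monoid_morphism.

(** For each of the three values of [n] the target reduces by computation to ['I_n]. *)
Lemma SL2_Zinv_ab_isomorphic : n \in [:: 3; 4; 12]%N ->
    (cl (e12 1) ^+ n = 1)%g ->
  isomorphic (ab (SL2 A)) 'I_(Zp_trunc n).+2.
Proof.
move=> n12 tn; apply: (@ab_isomorphic_ord _ _ _ (e12 1) (chi_mx Zinv_mod)).
- exact: e12_SL2.
- move=> g h Sg; rewrite {1}SL2_Zinv_eq_E2 => Eh.
  exact: (chi_mxM Zinv_mod (divides12_lawsP n12) Sg Eh).
- by rewrite chi_mx_e12 rmorph1; apply: val_inj.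
- by rewrite Zp_cast.
- exact: ab_e12_gen.
Qed.

End Reduction.
End ZinvTheory.

(* 'I_n.+1 is the additive group Z/(n+1). *)
Theorem proposition4p4 (m : nat) (m_sqfree : square_free m) :
  let C :=
    if (2 %| m)%N then (if (3 %| m)%N then ('I_1 : groupType) else ('I_3 : groupType))
    else (if (3 %| m)%N then ('I_4 : groupType) else ('I_12 : groupType)) in
  [/\ ab_set (SL2 (Zinv m)) = ab_set (E2 (Zinv m)),
      isomorphic (ab (SL2 (Zinv m))) C
    & isomorphic (ab (E2 (Zinv m))) C].
Proof.
(* Zero is divisible by 2^2, so it is not square-free. *)
have m_gt0 : (0 < m)%N.
  by case: m m_sqfree => // /(_ 2 (dvdn0 _)).
move=> C; rewrite -SL2_Zinv_eq_E2 //; suff iso : isomorphic (ab (SL2 (Zinv m))) C.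
  by split.
have t12 := ab_e12_order12 (Zinv m).
have t_dvd p : (p %| m)%N -> _ := fun pm =>
  let: ex_intro v pv := Zinv_unit_dvd m_gt0 pm in ab_e12_unit_nat pv.
set t := ab_class _ _ in t12 t_dvd.
have t3 : (2 %| m)%N -> (t ^+ 3 = 1)%g.
  by move=> /t_dvd t4; apply: (@mulgI _ t); rewrite -expgS mulg1.
(* The relation [t ^+ 9 = t] gives [t ^+ 8 = 1], and 12 = 8 + 4. *)
have t4 : (3 %| m)%N -> (t ^+ 4 = 1)%g.
  move=> /t_dvd t9; have t8 : (t ^+ 8 = 1)%g.
    by apply: (@mulgI _ t); rewrite -expgS mulg1.
  by rewrite -t12 (expgnDr t 8 4) t8 mul1g.
have co p : prime p -> coprime m p = ~~ (p %| m)%N.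
  by move=> p_pr; rewrite coprime_sym prime_coprime.
have co4 : coprime m 4 = coprime m 2 by apply: (coprime_pexpr m 2 (isT : 0 < 2)%N).
rewrite /C; have [m2|m2] := boolP (2 %| m)%N; have [m3|m3] := boolP (3 %| m)%N.
(* Here [t ^+ 3] and [t ^+ 4] are both trivial, hence so is [t], and the constant map serves as the
   character. *)
- apply: (@ab_isomorphic_ord _ _ 0 (e12 1) (fun=> 1%g)).
  + exact: e12_SL2.
  + by move=> g h _ _; rewrite mulg1.
  + exact: val_inj.
  + by have := t4 m3; rewrite expgSr t3 // mul1g.
  + exact: ab_e12_gen.
- by apply: (@SL2_Zinv_ab_isomorphic m m_gt0 3); rewrite ?co ?t3.
- by apply: (@SL2_Zinv_ab_isomorphic m m_gt0 4); rewrite ?co4 ?co ?t4.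
- apply: (@SL2_Zinv_ab_isomorphic m m_gt0 12) => //.
  by rewrite (coprimeMr m 4 3) co4 !co // m2.
Qed.
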